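(* Let $\delta\ge0$ and let $E$ and $F$ be unital operator systems. If $E$ and $F$ are (unitally) completely order isomorphic, then $\mathcal V_0^\delta(E,n)\cong\mathcal V_0^\delta(F,n)$ (as sets) for any $n\ge1$.
   Context: A unital operator system $(E,e)$ is a matrix-ordered $*$-vector space $E$ equipped with an Archimedean order unit $e$; $e_n$ denotes the diagonal matrix in $M_n(E)$ with entries $e$. For a linear map $\phi:E\to F$, $\phi^{(n)}:M_n(E)\to M_n(F)$ is $[x_{ij}]\mapsto[\phi(x_{ij})]$. ''cp'' means completely positive and ''ucp'' means unital completely positive. A (unital) complete order isomorphism is a bijective ucp map whose inverse is ucp. A dilation of a ucp map $\phi:E\to B(\mathcal H)$ is a ucp map $\psi:E\to B(\mathcal K)$ with $\mathcal K\supseteq\mathcal H$ a Hilbert space and $P_{\mathcal H}\psi(x)|_{\mathcal H}=\phi(x)$ for all $x\in E$. The ucp map $\phi$ is maximal if every dilation of $\phi$ is obtained by attaching a direct summand. A non-zero cp map $\phi:E\to B(\mathcal H)$ is pure if the only cp maps $\psi$ with $0\le\psi\le\phi$ are scalar multiples of $\phi$. For $\delta>0$, an element $x\in M_n(E)$ is $\delta$-singular if for all $s\in(0,\delta)$ there exists $g>0$ such that for all pure and maximal ucp maps $\phi:E\to B(\mathcal H)$ $$\left|\phi^{(2n)}\left(s\cdot e_{2n}+\begin{pmatrix}0&x\\ x^*&0\end{pmatrix}\right)\right|\ge g\cdot \mathrm{id}_{\mathcal H}^{\oplus 2n},\qquad |T|=(T^*T)^{1/2}.$$ For $\delta=0$,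 $x$ is $0$-singular if there is $g>0$ such that this inequality holds with $s=0$ for all pure and maximal ucp maps $\phi$. $H^\delta(E,n)$ denotes the set of $\delta$-singular self-adjoint elements of $M_n(E)$. For $x,x'\in H^\delta(E,n)$ write $x\sim_n x'$ if there exists $\tilde x\in H^\delta(C([0,1])\otimes E,n)$ with $\tilde x(0)=x$ and $\tilde x(1)=x'$; here $C([0,1])\otimes E$ is the operator system tensor product with unit $1\otimes e$, realized inside $C([0,1])\otimes C^*_{\mathrm{env}}(E)$, so that its elements are viewed as continuous functions on $[0,1]$. Define $\mathcal V_0^\delta(E,n)=H^\delta(E,n)/_{\sim_n}$. *)

(* Defs.v *)
From HB Require Import structures.
From mathcomp Require Import all_boot all_order all_algebra complex.
From mathcomp Require Import all_classical all_reals all_analysis.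

Set Implicit Arguments.
Unset Strict Implicit.
Unset Printing Implicit Defensive.

Import Order.TTheory GRing.Theory Num.Theory.
Import numFieldNormedType.Exports.

Local Open Scope classical_set_scope.
Local Open Scope ring_scope.

(* R[i] through the numClosedFieldType interface: this is what triggers the
   canonical topology and norm of a numFieldType. *)
Definition cplx (R : realType) : numClosedFieldType := R[i].

Section MatricesOverAModule.
Variables (R : realType) (V : lmodType (cplx R)).
Local Notation C := (cplx R).

Definition mxstar (star : V -> V) m n (x : 'M[V]_(m, n)) : 'M[V]_(n, m) :=
  map_mx star x^T.

(* a^* x a for a scalar matrix a *)
Definition mxcompress m n (a : 'M[C]_(m, n)) (x : 'M[V]_m) : 'M[V]_n :=
  \matrix_(k, l) \sum_i \sum_j ((a i k)^* * a j l) *: x i j.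

(* the diagonal matrix r . e_n *)
Definition mxdiag_unit n (r : R) (e : V) : 'M[V]_n :=
  \matrix_(i, j) (if i == j then (r%:C%C : C) *: e else 0).

End MatricesOverAModule.

(* The data of an operator system, without its axioms. B(H), C*-algebras and
   C([0,1]) (x) E are presented in this form as well, so that complete
   positivity is a single notion. *)
Record opsys_data (R : realType) := OpsysData {
  os_sort :> lmodType (cplx R);
  os_star : os_sort -> os_sort;
  os_cone : forall n, set 'M[os_sort]_n;
  os_unit : os_sort }.

Arguments os_star {R} _ _.
Arguments os_cone {R} _ _ _.
Arguments os_unit {R} _.

Definition selfadj (R : realType) (E : opsys_data R) n (x : 'M[E]_n) : Prop :=
  mxstar (os_star E) x = x.

Record is_opsys (R : realType) (E : opsys_data R) : Prop := IsOpsys {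
  os_starP : forall (a : cplx R) (x y : E),
    os_star E (a *: x + y) = a^* *: os_star E x + os_star E y;
  os_starK : involutive (os_star E);
  os_cone_sa : forall n (x : 'M[E]_n), os_cone E n x -> selfadj x;
  os_coneD : forall n (x y : 'M[E]_n),
    os_cone E n x -> os_cone E n y -> os_cone E n (x + y);
  os_coneZ : forall n (r : R) (x : 'M[E]_n), 0 <= r ->
    os_cone E n x -> os_cone E n (map_mx ( *:%R (r%:C%C : cplx R)) x);
  os_cone_proper : forall n (x : 'M[E]_n),
    os_cone E n x -> os_cone E n (- x) -> x = 0;
  os_cone_compress : forall m n (a : 'M[cplx R]_(m, n)) (x : 'M[E]_m),
    os_cone E m x -> os_cone E n (mxcompress a x);
  os_unit_sa : os_star E (os_unit E) = os_unit E;
  os_order_unit : forall n (x : 'M[E]_n), selfadj x ->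
    exists2 r : R, 0 < r & os_cone E n (mxdiag_unit n r (os_unit E) - x);
  os_archimedean : forall n (x : 'M[E]_n),
    (forall r : R, 0 < r -> os_cone E n (mxdiag_unit n r (os_unit E) + x)) ->
    os_cone E n x }.

Record opsys (R : realType) := Opsys {
  os_data :> opsys_data R;
  os_axioms : is_opsys os_data }.

Section CompletelyPositive.
Variables (R : realType) (E F : opsys_data R).

Definition cp (phi : {linear E -> F}) : Prop :=
  forall n (x : 'M[E]_n), os_cone E n x -> os_cone F n (map_mx phi x).

Definition ucp (phi : {linear E -> F}) : Prop :=
  cp phi /\ phi (os_unit E) = os_unit F.

Definition complete_order_embedding (phi : {linear E -> F}) : Prop :=
  [/\ ucp phi, injective phi &
      forall n (x : 'M[E]_n), os_cone F n (map_mx phi x) -> os_cone E n x].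

End CompletelyPositive.

Definition completely_order_isomorphic (R : realType) (E F : opsys_data R) :=
  exists (phi : {linear E -> F}) (psi : {linear F -> E}),
    [/\ cancel phi psi, cancel psi phi, ucp phi & ucp psi].

Record hilbert (R : realType) := Hilbert {
  hil_sort :> completeNormedModType (cplx R);
  hil_dot : {dot hil_sort for Num.conj};
  hil_normE : forall x : hil_sort, `|x| ^+ 2 = hil_dot x x }.

Section BoundedOperators.
Variables (R : realType) (H : hilbert R).
Local Notation C := (cplx R).

Definition bounded_op : {pred H -> H} :=
  [pred f : H -> H | `[< linear f /\ continuous f >]].

Lemma bounded_op_submod : submod_closed bounded_op.
Proof.
split.
  apply/asboolP; split; first by move=> a x y /=; rewrite scaler0 addr0.
  exact: cst_continuous.
move=> a f g /asboolP[fl fc] /asboolP[gl gc]; apply/asboolP; split.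
  move=> b x y.
  rewrite -[LHS]/(a *: f (b *: x + y) + g (b *: x + y)) fl gl.
  rewrite -[RHS]/(b *: (a *: f x + g x) + (a *: f y + g y)).
  by rewrite !scalerDr !scalerA mulrC addrACA.
by move=> x; apply: cvgD; [apply: cvgZl_tmp; exact: fc | exact: gc].
Qed.

HB.instance Definition _ := GRing.isSubmodClosed.Build _ _ bounded_op
  bounded_op_submod.

Record bop := Bop { bop_fun :> H -> H; _ : bop_fun \in bounded_op }.

HB.instance Definition _ := [isSub for bop_fun].
HB.instance Definition _ := [Choice of bop by <:].
HB.instance Definition _ := [SubChoice_isSubLmodule of bop by <:].

Lemma bop_linear (f : bop) : linear f.
Proof. by case: f => f /= /asboolP[]. Qed.

Lemma bop_continuous (f : bop) : continuous f.
Proof. by case: f => f /= /asboolP[]. Qed.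

Lemma bop_id_subproof : (id : H -> H) \in bounded_op.
Proof. by apply/asboolP; split=> // x. Qed.

Lemma bop_comp_subproof (f g : bop) : (f \o g) \in bounded_op.
Proof.
apply/asboolP; split; first by move=> a x y; rewrite /= !bop_linear.
by move=> x; apply: continuous_comp; exact: bop_continuous.
Qed.

Definition bop_id : bop := Bop bop_id_subproof.
Definition bop_comp (f g : bop) : bop := Bop (bop_comp_subproof f g).

Lemma bop_compA : associative bop_comp.
Proof. by move=> f g h; apply: val_inj. Qed.
Lemma bop_comp1f : left_id bop_id bop_comp.
Proof. by move=> f; apply: val_inj. Qed.
Lemma bop_compf1 : right_id bop_id bop_comp.
Proof. by move=> f; apply: val_inj. Qed.
Lemma bop_compDl : left_distributive bop_comp +%R.
Proof. by move=> f g h; apply: val_inj. Qed.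
Lemma bop_compDr : right_distributive bop_comp +%R.
Proof.
move=> f g h; apply: val_inj; apply/funext => x.
rewrite -[LHS]/(f (g x + h x)) -[RHS]/(f (g x) + f (h x)).
by have := bop_linear f 1 (g x) (h x); rewrite !scale1r.
Qed.

HB.instance Definition _ := GRing.Zmodule_isPzRing.Build bop
  bop_compA bop_comp1f bop_compf1 bop_compDl bop_compDr.

(* The adjoint exists by the Riesz representation theorem and is unique. *)
Definition adj (T : bop) : bop :=
  xget 0 [set S : bop | forall u v : H, hil_dot H (T u) v = hil_dot H u (S v)].

(* 'M[bop]_n acts on the column vectors H^n *)
Definition pos_op n (T : 'M[bop]_n) : Prop :=
  forall v : 'I_n -> H, 0 <= \sum_i \sum_j hil_dot H (T i j (v j)) (v i).

Definition BH : opsys_data R := @OpsysData R bop adj pos_op 1.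

(* |T| = (T^* T)^(1/2), the unique positive square root *)
Definition absop n (T : 'M[bop]_n) : 'M[bop]_n :=
  xget 0 [set S : 'M[bop]_n | pos_op S /\ S *m S = mxstar adj T *m T].

End BoundedOperators.

Section PureAndMaximal.
Variables (R : realType) (E : opsys_data R).
Local Notation C := (cplx R).

Definition pure (H : hilbert R) (phi : {linear E -> BH H}) : Prop :=
  [/\ cp phi, (exists x, phi x != 0) &
      forall psi : {linear E -> BH H}, cp psi -> cp (phi \- psi) ->
        exists c : C, forall x, psi x = c *: phi x].

Definition hil_isometry (H K : hilbert R) (V : {linear H -> K}) : Prop :=
  forall u v : H, hil_dot K (V u) (V v) = hil_dot H u v.

(* h is the orthogonal projection of k onto the copy V(H) of H inside K *)
Definition is_orthoproj (H K : hilbert R) (V : {linear H -> K}) (k : K) (h : H) :=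
  forall h' : H, hil_dot K (k - V h) (V h') = 0.

(* The inclusion of H into K is the linear isometry V. *)
Definition dilation (H K : hilbert R) (V : {linear H -> K})
    (phi : {linear E -> BH H}) (psi : {linear E -> BH K}) : Prop :=
  [/\ ucp psi, hil_isometry V &
      forall (x : E) (h : H), is_orthoproj V (psi x (V h)) (phi x h)].

(* psi = phi (+) chi with respect to K = H (+) L for some ucp chi on L *)
Definition direct_summand_attached (H K : hilbert R) (V : {linear H -> K})
    (phi : {linear E -> BH H}) (psi : {linear E -> BH K}) : Prop :=
  exists (L : hilbert R) (W : {linear L -> K}) (chi : {linear E -> BH L}),
    [/\ ucp chi, hil_isometry W,
        (forall h l, hil_dot K (V h) (W l) = 0),
        (forall k, exists h l, k = V h + W l) &
        forall x h l, psi x (V h + W l) = V (phi x h) + W (chi x l)].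

Definition maximal (H : hilbert R) (phi : {linear E -> BH H}) : Prop :=
  forall (K : hilbert R) (V : {linear H -> K}) (psi : {linear E -> BH K}),
    dilation V phi psi -> direct_summand_attached V phi psi.

End PureAndMaximal.

Section Singular.
Variables (R : realType) (E : opsys_data R) (n : nat).

(* s . e_2n + (0, x; x^*, 0) *)
Definition singular_mx (s : R) (x : 'M[E]_n) : 'M[E]_(n + n) :=
  mxdiag_unit (n + n) s (os_unit E) + block_mx 0 x (mxstar (os_star E) x) 0.

Definition singular_at (s : R) (x : 'M[E]_n) : Prop :=
  exists2 g : R, 0 < g &
    forall (H : hilbert R) (phi : {linear E -> BH H}),
      ucp phi -> pure phi -> maximal phi ->
      pos_op (absop (map_mx phi (singular_mx s x)) -
              mxdiag_unit (n + n) g (1 : bop H)).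

Definition delta_singular (delta : R) (x : 'M[E]_n) : Prop :=
  if delta == 0 then singular_at 0 x
  else forall s : R, 0 < s < delta -> singular_at s x.

Definition Hdelta (delta : R) : set 'M[E]_n :=
  [set x | delta_singular delta x /\ selfadj x].

End Singular.

(* 1 = 0 is allowed: the zero algebra is the envelope of the zero system. *)
Record cstarAlg (R : realType) := CStarAlg {
  ca_sort :> completeNormedModType (cplx R);
  ca_mul : ca_sort -> ca_sort -> ca_sort;
  ca_one : ca_sort;
  ca_star : ca_sort -> ca_sort;
  ca_mulA : associative ca_mul;
  ca_mul1x : left_id ca_one ca_mul;
  ca_mulx1 : right_id ca_one ca_mul;
  ca_mulPl : forall (a : cplx R) (x y z : ca_sort),
    ca_mul (a *: x + y) z = a *: ca_mul x z + ca_mul y z;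
  ca_mulPr : forall (a : cplx R) (x y z : ca_sort),
    ca_mul z (a *: x + y) = a *: ca_mul z x + ca_mul z y;
  ca_starP : forall (a : cplx R) (x y : ca_sort),
    ca_star (a *: x + y) = a^* *: ca_star x + ca_star y;
  ca_starK : involutive ca_star;
  ca_starM : forall x y : ca_sort,
    ca_star (ca_mul x y) = ca_mul (ca_star y) (ca_star x);
  ca_normM : forall x y : ca_sort, `|ca_mul x y| <= `|x| * `|y|;
  ca_norm_star : forall x : ca_sort, `|ca_mul (ca_star x) x| = `|x| ^+ 2 }.

Arguments ca_mul {R} _ _ _.
Arguments ca_one {R} _.
Arguments ca_star {R} _ _.

Section CStarAlgebras.
Variable R : realType.
Local Notation C := (cplx R).

(* b^* b in M_n(A) *)
Definition mxgram (A : cstarAlg R) n (b : 'M[A]_n) : 'M[A]_n :=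
  \matrix_(i, j) \sum_k ca_mul A (ca_star A (b k i)) (b k j).

Definition cstar_os (A : cstarAlg R) : opsys_data R :=
  @OpsysData R A (ca_star A)
    (fun n => [set x | exists b : 'M[A]_n, x = mxgram b]) (ca_one A).

Definition generates (A : cstarAlg R) (S : set A) : Prop :=
  forall B : set A, S `<=` B -> closed B ->
    (forall (a : C) x y, B x -> B y -> B (a *: x + y)) ->
    (forall x y, B x -> B y -> B (ca_mul A x y)) ->
    (forall x, B x -> B (ca_star A x)) ->
    B = setT.

(* Continuity is automatic for *-homomorphisms of C*-algebras. *)
Definition star_hom (A B : cstarAlg R) (pi : {linear A -> B}) : Prop :=
  [/\ forall x y, pi (ca_mul A x y) = ca_mul B (pi x) (pi y),
      forall x, pi (ca_star A x) = ca_star B (pi x) & continuous pi].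

Definition cstar_cover (E : opsys R) (A : cstarAlg R)
    (iota : {linear E -> cstar_os A}) : Prop :=
  complete_order_embedding iota /\ generates (range iota : set A).

(* The C*-envelope, i.e. the terminal C*-cover of E; it exists and is unique up
   to a *-isomorphism commuting with the embeddings of E. *)
Record cstar_env (E : opsys R) := CStarEnv {
  env_alg : cstarAlg R;
  env_map : {linear E -> cstar_os env_alg};
  env_cover : cstar_cover env_map;
  env_universal : forall (B : cstarAlg R) (j : {linear E -> cstar_os B}),
    cstar_cover j ->
    exists pi : {linear B -> env_alg},
      star_hom pi /\ forall x, pi (j x) = env_map x }.

Lemma cp_star (E : opsys R) (A : cstarAlg R) (f : {linear E -> cstar_os A}) :
  cp f -> forall x, f (os_star E x) = ca_star A (f x).
Proof.
have [starP starK cone_sa _ _ _ _ unit_sa order_unit arch] := os_axioms E.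
have starD x y : os_star E (x + y) = os_star E x + os_star E y.
  by have := starP 1 x y; rewrite conjC1 !scale1r.
have star0 : os_star E 0 = 0.
  by apply: (addrI (os_star E 0)); rewrite -starD !addr0.
have starZ a x : os_star E (a *: x) = a^* *: os_star E x.
  by have := starP a x 0; rewrite !addr0 star0 addr0.
have castarD x y : ca_star A (x + y) = ca_star A x + ca_star A y.
  by have := ca_starP 1 x y; rewrite conjC1 !scale1r.
have castar0 : ca_star A 0 = 0.
  by apply: (addrI (ca_star A 0)); rewrite -castarD !addr0.
have castarZ a x : ca_star A (a *: x) = a^* *: ca_star A x.
  by have := ca_starP a x 0; rewrite !addr0 castar0 addr0.
move=> fcp.
have fcone (x : E) : os_cone E 1 (const_mx x) -> ca_star A (f x) = f x.
  move=> /fcp[b /matrixP/(_ ord0 ord0)]; rewrite !mxE big_ord1 => ->.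
  by rewrite ca_starM ca_starK.
have fsa (x : E) : os_star E x = x -> ca_star A (f x) = f x.
  move=> xsa.
  have [|r r0 rx] := order_unit 1 (const_mx x).
    by apply/matrixP => i j; rewrite !mxE.
  have [|t t0 tx] := order_unit 1 0.
    by apply/matrixP => i j; rewrite !mxE.
  have conjR (u : R) : 0 < u -> ((u%:C)%C : cplx R)^* = (u%:C)%C.
    by move=> u0; apply: conj_Creal; apply: gtr0_real; rewrite ltcR.
  have diag1 (u : R) (z : E) : mxdiag_unit 1 u (os_unit E) - const_mx z =
      const_mx ((u%:C)%C *: os_unit E - z) :> 'M[E]_1.
    by apply/matrixP => i j; rewrite !mxE !ord1.
  have fe : ca_star A (f (os_unit E)) = f (os_unit E).
    move: tx; rewrite diag1 subr0 => /fcone.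
    rewrite linearZ /= castarZ conjR //; apply: scalerI.
    by rewrite gt_eqF // ltcR.
  move: rx; rewrite diag1 => /fcone.
  rewrite linearB linearZ /= castarD castarZ conjR // fe => /addrI.
  rewrite -[- f x]scaleN1r castarZ rmorphN1 !scaleN1r => /eqP.
  by rewrite eqr_opp => /eqP.
move=> x; pose h := 2^-1 *: (x + os_star E x).
pose k := (2^-1 * - 'i) *: (x - os_star E x).
have conj2 : (2^-1 : C)^* = 2^-1 by rewrite fmorphV rmorph_nat.
have conjk : (2^-1 * - 'i : C)^* = 2^-1 * 'i.
  by rewrite rmorphM rmorphN /= conjCi opprK conj2.
have starN y : os_star E (- y) = - os_star E y.
  by rewrite -scaleN1r starZ rmorphN1 scaleN1r.
have hsa : os_star E h = h by rewrite /h starZ starD starK conj2 addrC.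
have ksa : os_star E k = k.
  by rewrite /k starZ starD starN starK conjk -opprB scalerN -scaleNr -mulrN.
have i2 : 'i * (2^-1 * - 'i) = 2^-1 :> C.
  by rewrite mulrCA mulrN -expr2 sqrCi opprK mulr1.
have two y : 2^-1 *: y + 2^-1 *: y = y :> E.
  by rewrite -scalerDl -mulr2n -[_ *+ 2]mulr_natr mulVf ?scale1r // pnatr_eq0.
have xE : x = h + 'i *: k.
  rewrite /h /k scalerA i2 -scalerDr addrACA addrN addr0.
  by rewrite scalerDr two.
move: h k hsa ksa xE => h k hsa ksa xE.
have -> : os_star E x = h - 'i *: k.
  by rewrite [in LHS]xE starD hsa starZ ksa conjCi scaleNr.
rewrite [in RHS]xE linearB linearD !linearZ /= castarD castarZ !fsa //.
by rewrite conjCi scaleNr scalerN.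
Qed.

End CStarAlgebras.

Section ContinuousTensor.
Variables (R : realType) (E : opsys R) (N : cstar_env E).
Local Notation C := (cplx R).
Local Notation A := (env_alg N).

Definition unit_itv : set R := [set t | 0 <= t <= 1].

Lemma unit_itv0 : (0 : R) \in unit_itv.
Proof. by rewrite inE /unit_itv /= lexx ler01. Qed.
Lemma unit_itv1 : (1 : R) \in unit_itv.
Proof. by rewrite inE /unit_itv /= lexx ler01. Qed.

Definition I0 : unit_itv := SigSub unit_itv0.
Definition I1 : unit_itv := SigSub unit_itv1.

(* The linear span of the elementary tensors f (x) x, i.e. t |-> f(t) x, inside
   C([0,1]) (x) C*_env(E) = C([0,1], C*_env(E)). *)
Definition tensor_pred : {pred unit_itv -> A} :=
  [pred h : unit_itv -> A | `[< exists m (f : 'I_m -> unit_itv -> C) (x : 'I_m -> E),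
    (forall k, continuous (f k)) /\
    h = fun t => \sum_k f k t *: env_map N (x k) >]].

Lemma tensor_submod : submod_closed tensor_pred.
Proof.
split.
  apply/asboolP; exists 0%N, (fun=> cst 0), (fun=> 0); split.
    by move=> k; exact: cst_continuous.
  by apply/funext => t; rewrite big_ord0.
move=> a g h /asboolP[m [f [x [fc ->]]]] /asboolP[p [f' [x' [fc' ->]]]].
apply/asboolP; exists (m + p)%N,
  (fun k : 'I_(m + p) => match fintype.split k with
            | inl i => fun t => a * f i t | inr j => f' j end),
  (fun k : 'I_(m + p) => match fintype.split k with inl i => x i | inr j => x' j end).
split.
  move=> k; case: (fintype.split k) => [i t|j]; last exact: fc'.
  exact: (cvgM (cvg_cst a) (fc i t)).
apply/funext => t; rewrite big_split_ord /=.
rewrite -[LHS]/(a *: (\sum_k f k t *: env_map N (x k)) +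
  \sum_k f' k t *: env_map N (x' k)) scaler_sumr.
congr (_ + _); apply: eq_bigr => i _.
  by rewrite (unsplitK (inl i)) scalerA.
by rewrite (unsplitK (inr i)).
Qed.

HB.instance Definition _ := GRing.isSubmodClosed.Build _ _ tensor_pred
  tensor_submod.

Record ctensor := CTensor {
  ctensor_fun :> unit_itv -> A; _ : ctensor_fun \in tensor_pred }.

HB.instance Definition _ := [isSub for ctensor_fun].
HB.instance Definition _ := [Choice of ctensor by <:].
HB.instance Definition _ := [SubChoice_isSubLmodule of ctensor by <:].

Lemma conj_continuous : continuous (Num.conj : C -> C).
Proof.
move=> z B [e e0 zeB]; exists e => // u zu; apply: zeB.
by rewrite /ball_ /= -rmorphB norm_conjC.
Qed.

Lemma ctensor_star_subproof (h : ctensor) :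
  (fun t => ca_star A (h t)) \in tensor_pred.
Proof.
case: h => h /= /asboolP[m [f [x [fc ->]]]]; apply/asboolP.
exists m, (fun k t => (f k t)^*), (fun k => os_star E (x k)); split.
  move=> k t; apply: (@continuous_comp _ _ _ (f k) (Num.conj : C -> C)).
    exact: fc.
  exact: conj_continuous.
apply/funext => t.
have castarD y z : ca_star A (y + z) = ca_star A y + ca_star A z.
  by have := ca_starP 1 y z; rewrite conjC1 !scale1r.
have castar0 : ca_star A 0 = 0.
  by apply: (addrI (ca_star A 0)); rewrite -castarD !addr0.
rewrite (big_morph (ca_star A) castarD castar0); apply: eq_bigr => k _.
rewrite cp_star; last by case: (env_cover N) => -[[]].
by have := ca_starP (f k t) (env_map N (x k)) 0; rewrite !addr0 castar0 addr0.
Qed.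

Lemma ctensor_unit_subproof : (fun=> ca_one A) \in tensor_pred.
Proof.
apply/asboolP; exists 1%N, (fun=> cst 1), (fun=> os_unit E); split.
  by move=> k; exact: cst_continuous.
apply/funext => t; rewrite big_ord1 scale1r.
by case: (env_cover N) => -[[_ ->]].
Qed.

(* The cones are those of the C*-algebra C([0,1], C*_env(E)): the elements
   b^* b with b in M_n(C([0,1], C*_env(E))). *)
Definition ctensor_cone n : set 'M[ctensor]_n :=
  [set h | exists b : unit_itv -> 'M[A]_n,
    (forall i j, continuous (fun t => b t i j)) /\
    forall t, map_mx (fun g : ctensor => g t) h = mxgram (b t)].

Definition ctensor_os : opsys_data R :=
  @OpsysData R ctensor (fun h => CTensor (ctensor_star_subproof h))
    ctensor_cone (CTensor ctensor_unit_subproof).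

Definition ev n (t : unit_itv) (h : 'M[ctensor]_n) : 'M[A]_n :=
  map_mx (fun g : ctensor => g t) h.

(* The endpoints are compared inside M_n(C*_env(E)), which contains M_n(E). *)
Definition homotopic (delta : R) n (x x' : 'M[E]_n) : Prop :=
  exists h : 'M[ctensor_os]_n,
    [/\ Hdelta delta h, ev I0 h = map_mx (env_map N) x
      & ev I1 h = map_mx (env_map N) x'].

(* The set of equivalence classes. *)
Definition V0 (delta : R) n : set (set 'M[E]_n) :=
  [set c | exists2 x, Hdelta delta x &
    c = [set x' | Hdelta delta x' /\ homotopic delta x x']].

End ContinuousTensor.

Arguments V0 {R E} N delta n _.

(* Main.v *)
Require Import Defs.
From HB Require Import structures.
From mathcomp Require Import all_boot all_order all_algebra.
From mathcomp Require Import all_classical all_reals all_analysis.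

(** Everything entering [V0] is defined through ucp maps, so an isomorphism of
operator systems transports it; the work is in transporting homotopies.

Let [phi : E -> F] and [psi : F -> E] be mutually inverse ucp maps.
Precomposition with [phi] turns the pure and maximal ucp maps on [F] into pure
and maximal ucp maps on [E]: a cp map below [chi \o phi] is, after
precomposition with [psi], a cp map below [chi], and likewise for dilations.
As the inequality defining delta-singularity only involves the matrix
[chi (s e + (0, phi x; phi x^*, 0))], which is the image under [chi \o phi] of
[s e + (0, x; x^*, 0)], the same constant [g] serves for [x] and for [phi x]
([Hdelta_map]).

A homotopy is a self-adjoint delta-singular matrix over the system
[C([0,1]) (x) E], so the same lemma applies to it once [phi (x) id] is known to
be an isomorphism [C([0,1]) (x) E -> C([0,1]) (x) F]. These tensor products,
including their order, are defined inside the functions with values in the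
C*-envelopes. Now [env_map NE \o psi] makes the envelope of [E] a C*-cover of
[F], so the universal property of the envelope of [F] yields a *-homomorphism
between the envelopes extending [phi] ([cstar_env_map]), and by symmetry one
extending [psi]. Applying them pointwise gives mutually inverse ucp maps of the
tensor products ([ctensor_isomorphism]), whence [phi] maps homotopic elements
to homotopic elements ([homotopic_map]).

Therefore the image under [phi] of the class of [x] is the class of [phi x],
and [c |-> phi @` c] is the required bijection. *)

Set Implicit Arguments.
Unset Strict Implicit.
Unset Printing Implicit Defensive.

Import Order.TTheory GRing.Theory Num.Theory.
Import numFieldNormedType.Exports.

Local Open Scope classical_set_scope.
Local Open Scope card_scope.
Local Open Scope ring_scope.

Section Composition.
Variable R : realType.

Lemma cp_comp (E F G : opsys_data R) (f : {linear F -> G})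
  (g : {linear E -> F}) : cp f -> cp g -> cp (f \o g).
Proof. by move=> fcp gcp n x /gcp/fcp; rewrite -map_mx_comp. Qed.

Lemma ucp_comp (E F G : opsys_data R) (f : {linear F -> G})
  (g : {linear E -> F}) : ucp f -> ucp g -> ucp (f \o g).
Proof.
by move=> [fcp f1] [gcp g1]; split; [exact: cp_comp | rewrite /= g1 f1].
Qed.

Lemma eq_cp (E F : opsys_data R) (f g : {linear E -> F}) :
  f =1 g -> cp f -> cp g.
Proof. by move=> fg fcp n x /fcp; rewrite (eq_map_mx _ fg). Qed.

Lemma map_mxK (S T : Type) (f : S -> T) (g : T -> S) m n :
  cancel f g -> cancel (@map_mx _ _ f m n) (map_mx g).
Proof. by move=> fK x; rewrite -map_mx_comp map_mx_id. Qed.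

Lemma image_map_mxK (S T : Type) (f : S -> T) (g : T -> S) m n :
  cancel f g -> cancel (image^~ (@map_mx _ _ f m n)) (image^~ (map_mx g)).
Proof.
by move=> /map_mxK fK c; rewrite /= image_comp eq_image_id // => x _; exact: fK.
Qed.

Definition inverse_ucp (E F : opsys_data R) (phi : {linear E -> F})
    (psi : {linear F -> E}) : Prop :=
  [/\ cancel phi psi, cancel psi phi, ucp phi & ucp psi].

Lemma inverse_ucp_sym (E F : opsys_data R) (phi : {linear E -> F})
    (psi : {linear F -> E}) :
  inverse_ucp phi psi -> inverse_ucp psi phi.
Proof. by case. Qed.

End Composition.

(** * Transport of pure and maximal maps and of singular elements *)

Section Transport.
Variables (R : realType) (E F : opsys_data R).
Variables (phi : {linear E -> F}) (psi : {linear F -> E}).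
Hypothesis phi_psi : inverse_ucp phi psi.

(** A cp map dominated by [chi \o phi] becomes, after precomposition with
[psi], a cp map dominated by [chi]; the resulting scalar is then read off back
along [phi]. *)
Lemma pure_comp (H : hilbert R) (chi : {linear F -> BH H}) :
  pure chi -> pure (chi \o phi).
Proof.
have [phiK psiK [phicp _] [psicp _]] := phi_psi.
move=> [chicp [y chiy0] chimin]; split.
- exact: cp_comp.
- by exists (psi y); rewrite /= psiK.
- move=> theta thetacp dcp.
  have [|c thetaE] := chimin (theta \o psi) (cp_comp thetacp psicp).
    apply: eq_cp (cp_comp dcp psicp) => z.
    by rewrite /= psiK.
  by exists c => x; rewrite /= -thetaE /= phiK.
Qed.

(** A dilation [theta] of [chi \o phi] yields the dilation [theta \o psi] of
[chi]; composing the summand of the latter with [phi] gives the summand of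
[theta]. *)
Lemma maximal_comp (H : hilbert R) (chi : {linear F -> BH H}) :
  maximal chi -> maximal (chi \o phi).
Proof.
have [phiK psiK phiucp psiucp] := phi_psi.
move=> chimax K V theta [thetaucp Viso thetadil].
have [|L [W [om [omucp Wiso VW KVW thetaE]]]] := chimax K V (theta \o psi).
  split=> //; first exact: ucp_comp.
  by move=> y h; have := thetadil (psi y) h; rewrite /= psiK.
exists L, W, (om \o phi); split=> //; first exact: ucp_comp.
by move=> x h l; have := thetaE (phi x) h l; rewrite /= phiK.
Qed.

Hypothesis phi_star : forall x, phi (os_star E x) = os_star F (phi x).

Lemma map_mxstar m n (x : 'M[E]_(m, n)) :
  map_mx phi (mxstar (os_star E) x) = mxstar (os_star F) (map_mx phi x).
Proof. by apply/matrixP => i j; rewrite !mxE phi_star. Qed.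

Lemma map_singular_mx n (s : R) (x : 'M[E]_n) :
  map_mx phi (singular_mx s x) = singular_mx s (map_mx phi x).
Proof.
have [_ _ [_ phi1] _] := phi_psi.
rewrite /singular_mx map_mxD map_block_mx !map_mx0 map_mxstar; congr (_ + _).
apply/matrixP => i j; rewrite !mxE /=.
by case: ifP => _; rewrite ?raddf0 // linearZ /= phi1.
Qed.

Lemma singular_at_map n (s : R) (x : 'M[E]_n) :
  singular_at s x -> singular_at s (map_mx phi x).
Proof.
have [_ _ phiucp _] := phi_psi.
move=> [g g0 xg]; exists g => // H chi chiucp chipure chimax.
have := xg H (chi \o phi) (ucp_comp chiucp phiucp) (pure_comp chipure)
  (maximal_comp chimax).
by rewrite map_mx_comp map_singular_mx.
Qed.

(** Stated for [opsys_data] so as to cover both the systems themselves, where it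
transports singular elements, and their tensor products with C([0,1]), where it
transports homotopies. *)
Lemma Hdelta_map (delta : R) n (x : 'M[E]_n) :
  Hdelta delta x -> Hdelta delta (map_mx phi x).
Proof.
move=> [xsing xsa]; split; last by rewrite /selfadj -map_mxstar xsa.
move: xsing; rewrite /delta_singular; case: ifP => _.
  exact: singular_at_map.
by move=> xsing s /xsing; exact: singular_at_map.
Qed.

End Transport.

(** * C*-envelopes of isomorphic operator systems *)

Section Envelopes.
Variable R : realType.

(** Adjoints in an operator system may be computed in its C*-envelope, where cp
maps into C*-algebras are known to preserve them. *)
Lemma cp_os_star (E F : opsys R) (NF : cstar_env F) (phi : {linear E -> F}) :
  cp phi -> forall x, phi (os_star E x) = os_star F (phi x).
Proof.
move=> phicp x; have [[[iotacp _] iota_inj _] _] := env_cover NF.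
apply: iota_inj; rewrite (cp_star iotacp).
exact: (cp_star (cp_comp iotacp phicp)).
Qed.

Lemma cstar_cover_comp (E F : opsys R) (A : cstarAlg R)
    (iota : {linear E -> cstar_os A}) (phi : {linear E -> F})
    (psi : {linear F -> E}) :
  inverse_ucp phi psi -> cstar_cover iota -> cstar_cover (iota \o psi).
Proof.
move=> [phiK psiK [phicp _] psiucp] [[iotaucp iota_inj iota_refl] gen]; split.
  split; first exact: ucp_comp.
    exact: inj_comp iota_inj (can_inj psiK).
  move=> n y; rewrite map_mx_comp => /iota_refl/phicp.
  by rewrite -map_mx_comp map_mx_id.
suff -> : range (iota \o psi) = range iota by [].
apply/seteqP; split=> _ [x _ <-]; first by exists (psi x).
by exists (phi x) => //=; rewrite phiK.
Qed.

(** The envelope of [E] is a C*-cover of [F] through [psi], so it maps to the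
terminal such cover. *)
Lemma cstar_env_map (E F : opsys R) (NE : cstar_env E) (NF : cstar_env F)
    (phi : {linear E -> F}) (psi : {linear F -> E}) :
  inverse_ucp phi psi ->
  exists pi : {linear env_alg NE -> env_alg NF},
    star_hom pi /\ forall x, pi (env_map NE x) = env_map NF (phi x).
Proof.
move=> phi_psi; have [phiK _ _ _] := phi_psi.
have [pi [pihom piE]] :=
  env_universal NF (cstar_cover_comp phi_psi (env_cover NE)).
by exists pi; split=> // x; rewrite -piE /= phiK.
Qed.

Lemma star_hom_mxgram (A B : cstarAlg R) (pi : {linear A -> B}) n
    (b : 'M[A]_n) :
  star_hom pi -> map_mx pi (mxgram b) = mxgram (map_mx pi b).
Proof.
move=> [piM pistar _]; apply/matrixP => i j; rewrite !mxE linear_sum.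
by apply: eq_bigr => k _; rewrite piM pistar !mxE.
Qed.

End Envelopes.

(** * The tensor product with C([0,1]) *)

Section TensorMap.
Variables (R : realType) (E F : opsys R).
Variables (NE : cstar_env E) (NF : cstar_env F) (phi : {linear E -> F}).
Variable pi : {linear env_alg NE -> env_alg NF}.
Hypothesis pi_hom : star_hom pi.
Hypothesis pi_env : forall x, pi (env_map NE x) = env_map NF (phi x).

(* The span of the elementary tensors is preserved since [pi] sends the copy of
   [E] to the copy of [F]. *)
Lemma tensor_map_subproof (h : ctensor NE) :
  (fun t => pi (h t)) \in tensor_pred (N := NF).
Proof.
case: h => h /= /asboolP[m [f [x [fc ->]]]]; apply/asboolP.
exists m, f, (phi \o x); split=> //; apply/funext => t.
by rewrite linear_sum; apply: eq_bigr => k _; rewrite linearZ /= pi_env.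
Qed.

Definition tensor_map (h : ctensor_os NE) : ctensor_os NF :=
  CTensor (tensor_map_subproof h).

Lemma tensor_map_is_linear : linear tensor_map.
Proof.
by move=> a g h; apply: val_inj; apply/funext => t; rewrite /= linearP.
Qed.

HB.instance Definition _ := GRing.isLinear.Build _ _ _ _ tensor_map
  tensor_map_is_linear.

Lemma tensor_map_star h :
  tensor_map (os_star (ctensor_os NE) h) =
  os_star (ctensor_os NF) (tensor_map h).
Proof.
have [_ pistar _] := pi_hom.
by apply: val_inj; apply/funext => t; rewrite /= pistar.
Qed.

Lemma ev_tensor_map n (t : @unit_itv R) (h : 'M[ctensor_os NE]_n) :
  ev t (map_mx tensor_map h) = map_mx pi (ev t h).
Proof. by apply/matrixP => i j; rewrite !mxE. Qed.

Lemma tensor_map_ucp : phi (os_unit E) = os_unit F -> ucp tensor_map.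
Proof.
move=> phi1; have [_ _ picont] := pi_hom; split.
  move=> n h [b [bcont hE]]; exists (fun t => map_mx pi (b t)); split.
    move=> i j; under eq_fun do rewrite mxE.
    by move=> t; apply: continuous_comp; [exact: bcont | exact: picont].
  by move=> t; rewrite -star_hom_mxgram // -hE; exact: ev_tensor_map.
have [[[_ iotaE1] _ _] _] := env_cover NE.
have [[[_ iotaF1] _ _] _] := env_cover NF.
apply: val_inj; apply/funext => t.
rewrite -[LHS]/(pi (os_unit (cstar_os (env_alg NE)))) -iotaE1 pi_env phi1.
exact: iotaF1.
Qed.

End TensorMap.

Section TensorIsomorphism.
Variable R : realType.

(** Tensors take their values in the copies of [E] and [F] in the envelopes,
where [pi] and [rho] act as [phi] and [psi]. *)
Lemma tensor_mapK (E F : opsys R) (NE : cstar_env E) (NF : cstar_env F)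
    (phi : {linear E -> F}) (psi : {linear F -> E})
    (pi : {linear env_alg NE -> env_alg NF})
    (rho : {linear env_alg NF -> env_alg NE})
    (pi_env : forall x, pi (env_map NE x) = env_map NF (phi x))
    (rho_env : forall y, rho (env_map NF y) = env_map NE (psi y)) :
  cancel phi psi -> cancel (tensor_map pi_env) (tensor_map rho_env).
Proof.
move=> phiK h; apply: val_inj; apply/funext => t /=.
case: h => h /= /asboolP[m [f [x [_ ->]]]]; rewrite !linear_sum.
by apply: eq_bigr => k _; rewrite !linearZ /= pi_env rho_env phiK.
Qed.

(** The homomorphism [pi] is part of the conclusion because endpoints of
homotopies are compared inside the envelopes. *)
Lemma ctensor_isomorphism (E F : opsys R) (NE : cstar_env E)
    (NF : cstar_env F) (phi : {linear E -> F}) (psi : {linear F -> E}) :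
  inverse_ucp phi psi ->
  exists (pi : {linear env_alg NE -> env_alg NF})
         (Phi : {linear ctensor_os NE -> ctensor_os NF})
         (Psi : {linear ctensor_os NF -> ctensor_os NE}),
    [/\ inverse_ucp Phi Psi,
        forall h, Phi (os_star (ctensor_os NE) h) =
                  os_star (ctensor_os NF) (Phi h),
        forall x, pi (env_map NE x) = env_map NF (phi x) &
        forall n t (h : 'M[ctensor_os NE]_n),
          ev t (map_mx Phi h) = map_mx pi (ev t h)].
Proof.
move=> phi_psi; have [phiK psiK [_ phi1] [_ psi1]] := phi_psi.
have [pi [pihom pi_env]] := cstar_env_map NE NF phi_psi.
have [rho [rhohom rho_env]] := cstar_env_map NF NE (inverse_ucp_sym phi_psi).
exists pi, (tensor_map pi_env), (tensor_map rho_env); split=> //.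
- split; [exact: tensor_mapK | exact: tensor_mapK | |].
    exact: tensor_map_ucp pihom _ phi1.
  exact: tensor_map_ucp rhohom _ psi1.
- exact: tensor_map_star.
- exact: ev_tensor_map.
Qed.

End TensorIsomorphism.

(** * Homotopy classes *)

Section HomotopyClasses.
Variables (R : realType) (delta : R).

Lemma homotopic_map (E F : opsys R) (NE : cstar_env E) (NF : cstar_env F)
    (phi : {linear E -> F}) (psi : {linear F -> E}) n (x x' : 'M[E]_n) :
  inverse_ucp phi psi -> homotopic NE delta x x' ->
  homotopic NF delta (map_mx phi x) (map_mx phi x').
Proof.
move=> phi_psi [h [hsing h0 h1]].
have [pi [Phi [Psi [Phi_Psi Phi_star pi_env evPhi]]]] :=
  ctensor_isomorphism NE NF phi_psi.
have pi_map (y : 'M[E]_n) :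
    map_mx pi (map_mx (env_map NE) y) = map_mx (env_map NF) (map_mx phi y).
  by apply/matrixP => i j; rewrite !mxE pi_env.
exists (map_mx Phi h); split.
- exact: Hdelta_map Phi_Psi Phi_star _ _ _ hsing.
- by rewrite evPhi h0 pi_map.
- by rewrite evPhi h1 pi_map.
Qed.

Definition homotopy_class (E : opsys R) (NE : cstar_env E) n (x : 'M[E]_n) :
    set 'M[E]_n :=
  [set x' | Hdelta delta x' /\ homotopic NE delta x x'].

Lemma map_homotopy_class_sub (E F : opsys R) (NE : cstar_env E)
    (NF : cstar_env F) (phi : {linear E -> F}) (psi : {linear F -> E}) n
    (x : 'M[E]_n) :
  inverse_ucp phi psi ->
  map_mx phi @` homotopy_class NE x `<=` homotopy_class NF (map_mx phi x).
Proof.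
move=> phi_psi _ [x' [x'sing xx'] <-]; have [_ _ [phicp _] _] := phi_psi.
split; last exact: homotopic_map phi_psi xx'.
exact: Hdelta_map phi_psi (cp_os_star NF phicp) _ _ _ x'sing.
Qed.

(** The reverse inclusion is [map_homotopy_class_sub] for the inverse
isomorphism. *)
Lemma map_homotopy_class (E F : opsys R) (NE : cstar_env E)
    (NF : cstar_env F) (phi : {linear E -> F}) (psi : {linear F -> E}) n
    (x : 'M[E]_n) :
  inverse_ucp phi psi ->
  map_mx phi @` homotopy_class NE x = homotopy_class NF (map_mx phi x).
Proof.
move=> phi_psi; apply/seteqP; split.
  by move=> y; apply: (map_homotopy_class_sub NF phi_psi).
have [phiK psiK _ _] := phi_psi => y yx; exists (map_mx psi y).
  rewrite -[x in homotopy_class NE x](map_mxK phiK).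
  apply: (map_homotopy_class_sub (NE := NF) NE (inverse_ucp_sym phi_psi)).
  by exists y.
exact: (map_mxK psiK).
Qed.

Lemma map_V0_sub (E F : opsys R) (NE : cstar_env E) (NF : cstar_env F)
    (phi : {linear E -> F}) (psi : {linear F -> E}) n :
  inverse_ucp phi psi ->
  forall c, V0 NE delta n c -> V0 NF delta n (map_mx phi @` c).
Proof.
move=> phi_psi _ [x xsing ->]; have [_ _ [phicp _] _] := phi_psi.
exists (map_mx phi x); last exact: (map_homotopy_class NE NF x phi_psi).
exact: Hdelta_map phi_psi (cp_os_star NF phicp) _ _ _ xsing.
Qed.

End HomotopyClasses.

Theorem proposition7 (R : realType) (delta : R) (E F : opsys R)
    (NE : cstar_env E) (NF : cstar_env F) :
  0 <= delta -> completely_order_isomorphic E F ->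
  forall n : nat, (1 <= n)%N -> V0 NE delta n #= V0 NF delta n.
Proof.
move=> _ [phi [psi phi_psi]] n _; have [phiK psiK _ _] := phi_psi.
have image_phiK := @image_map_mxK _ _ _ _ n n phiK.
have image_psiK := @image_map_mxK _ _ _ _ n n psiK.
suff -> : V0 NF delta n = image^~ (map_mx phi) @` V0 NE delta n.
  rewrite card_eq_sym; apply: inj_card_eq => c d _ _.
  exact: can_inj image_phiK _ _.
apply/seteqP; split=> [d dV | _ [c cV <-]]; last exact: map_V0_sub phi_psi _ cV.
exists (map_mx psi @` d); last exact: image_psiK.
exact: map_V0_sub (inverse_ucp_sym phi_psi) _ dV.
Qed.
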